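(* Let $\Gamma$ be an $n$-player extensive-form game with perfect recall. For fixed $\xi\in\Xi$, the value of the linear program, in the variables $u\in\mathbb R$ and $v_i\in\mathbb R^{|\mathcal I_i|+1}$ ($i=1,\dots,n$), $$\begin{array}{rll}\min & u\\ \text{s.t.} & u-v_i^\top f_i+b_i^\top\xi\ge0 & \forall i\in\{1,\dots,n\}\\ & F_i^\top v_i-A_i^\top\xi\ge 0 & \forall i\in\{1,\dots,n\}\end{array}$$ equals the maximum deviation benefit $\hat u_i-u_i$ across all players $i\in\{1,\dots,n\}$ and probability distributions $\hat\mu_i$ over $\Pi_i$. Hence, for any given linear objective $c^\top\xi$, one can find an NFCCE $\xi$ that maximizes $c^\top\xi$ by solving the linear program, in the variables $\xi$, $u\in\mathbb R$ and $v_i\in\mathbb R^{|\mathcal I_i|+1}$ ($i=1,\dots,n$), $$\begin{array}{rll}\max & c^\top\xi\\ \text{s.t.} & u-v_i^\top f_i+b_i^\top\xi\ge0 & \forall i\in\{1,\dots,n\}\\ & F_i^\top v_i-A_i^\top\xi\ge 0 & \forall i\in\{1,\dots,n\}\\ & u\le 0,\quad \xi\in\Xi.\end{array}$$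
   Context: **Game.** $\Gamma$ is an $n$-player extensive-form game with perfect recall. Each non-leaf node $v$ belongs to a player $i\in\{1,\dots,n\}$ or to the chance player $\mathsf c$; $A_v$ is its set of actions. $Z$ is the set of leaves, $u_i(z)\in\mathbb R$ Player $i$'s payoff at $z$. The nodes of Player $i$ are partitioned into a collection $\mathcal I_i$ of information sets, with common action set $A_I$ at $I$. **Sequences.** $\Sigma_i=\{(I,a): I\in\mathcal I_i,a\in A_I\}\cup\{\varnothing_i\}$. For a node $v$, $\sigma_i(v)$ is the last $(I,a)\in\Sigma_i$ encountered on the path from the root to $v$, or $\varnothing_i$ if none; $\sigma_i(I)=\sigma_i(v)$ for any $v\in I\in\mathcal I_i$. Information sets $I_i\in\mathcal I_i$, $I_j\in\mathcal I_j$ are connected if there are $u\in I_i$, $v\in I_j$ such that the path from the root to $u$ passes through $v$ or vice versa. For $i\neq j$, sequences $\sigma_i\in\Sigma_i$, $\sigma_j\in\Sigma_j$ are relevant if one of them is empty or their information sets are connected. **Plans.** A reduced-normal-form plan $\pi$ of Player $i$ selects an action $\pi(I)\in A_I$ at exactly those $I\in\mathcal I_i$ reachable given its own other choices. $\Pi_i$ is the set of such plans; $\Pi_i(\varnothing_i)=\Pi_i$, $\Pi_i((I,a))=\Pi_i(\sigma_i(I))\cap\{\pi:\pi(I)=a\}$, and $\Pi_i(z)=\Pi_i(\sigma_i(z))$ for $z\in Z$. **Sequence-form strategies.** $Q_i\subseteq\mathbb R_{\ge0}^{\Sigma_i}$ is the set of vectors $y$ of the form $y(\sigma)=\sum_{\pi\in\Pi_i(\sigma)}\hat\mu(\pi)$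 for a probability distribution $\hat\mu$ over $\Pi_i$. It is known (Koller–Megiddo–von Stengel) that $Q_i=\{y\ge0: F_iy=f_i\}$, where $F_iy=f_i$ denotes the linear system consisting of $y(\varnothing_i)=1$ and $\sum_{a\in A_I}y((I,a))-y(\sigma_i(I))=0$ for all $I\in\mathcal I_i$. **Correlation plans.** A distribution $\mu$ over $\Pi_1\times\dots\times\Pi_n$ induces the vector $\xi$, indexed by tuples $(\sigma_1,\dots,\sigma_n)\in\Sigma_1\times\dots\times\Sigma_n$ of pairwise-relevant sequences, with $\xi(\sigma_1,\dots,\sigma_n)=\sum_{\pi_1\in\Pi_1(\sigma_1),\dots,\pi_n\in\Pi_n(\sigma_n)}\mu(\pi_1,\dots,\pi_n)$. $\Xi$ is the set (a polytope) of all such $\xi$. Write $\xi_i(\sigma;z)=\xi(\sigma_1(z),\dots,\sigma_{i-1}(z),\sigma,\sigma_{i+1}(z),\dots,\sigma_n(z))$. **Matrices.** $A_i$ and $b_i$ are the matrix and vector, depending (for the given game) only on $i$, with $\xi^\top A_iy=\sum_{z\in Z}u_i(z)\xi_i(\varnothing_i;z)\,y(\sigma_i(z))$ and $b_i^\top\xi=\sum_{z\in Z}u_i(z)\xi_i(\sigma_i(z);z)$ for all $\xi$ and $y\in\mathbb R^{\Sigma_i}$. **NFCCE (normal-form coarse-correlated equilibrium).** $\mu$ is an NFCCE if for every player $i$ and every probability distribution $\hat\mu_i$ over $\Pi_i$ (independent of $\mu$), $\hat u_i\le u_i$, where the utility of deviating to $\hat\mu_i$ and the utility of committing to the recommendations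 are expressed as $$\hat u_i=\sum_{z\in Z}u_i(z)\Big(\sum_{\pi_i\in\Pi_i,\ \pi_j\in\Pi_j(z)\,\forall j\ne i}\mu(\pi_1,\dots,\pi_n)\Big)\Big(\sum_{\pi_i\in\Pi_i(z)}\hat\mu_i(\pi_i)\Big),\qquad u_i=\sum_{z\in Z}u_i(z)\sum_{\pi_j\in\Pi_j(z)\,\forall j}\mu(\pi_1,\dots,\pi_n).$$ Both depend on $\mu$ only through the induced $\xi$. A correlation plan $\xi\in\Xi$ is called an NFCCE if it is induced by some $\mu$ that is an NFCCE. *)

(* Defs.v *)
From HB Require Import structures.
From mathcomp Require Import all_boot all_order all_algebra.
From mathcomp Require Import reals.

Set Implicit Arguments.
Unset Strict Implicit.
Unset Printing Implicit Defensive.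

Import Order.TTheory GRing.Theory Num.Theory.
Local Open Scope ring_scope.

(* The game tree is a finite prefix-closed set                                *)
(* of histories: a node is the sequence of actions leading to it from the    *)
(* root [::], and v lies on the path from the root to u iff prefix v u.      *)

Definition tree_acts (act : finType) (hist : seq (seq act))
    (v : seq_sub hist) : {set act} :=
  [set a | rcons (val v) a \in hist].

Definition tree_leaf (act : finType) (hist : seq (seq act))
    (v : seq_sub hist) : bool :=
  tree_acts v == set0.

Record tree_leaves (act : finType) (hist : seq (seq act)) := Leaf {
  leaf_node : seq_sub hist;
  leaf_nodeP : tree_leaf leaf_node }.

HB.instance Definition _ (act : finType) (hist : seq (seq act)) :=
  [isSub for @leaf_node act hist].
HB.instance Definition _ (act : finType) (hist : seq (seq act)) :=
  [Finite of tree_leaves hist by <:].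

(* owner v = None at the nodes of the chance player; the value of owner at   *)
(* leaves is irrelevant.  There is no separate datum of chance               *)
(* probabilities: the payoff u_i(z) enters every utility without any further *)
(* weight, i.e. the probability with which chance plays towards z is already *)
(* part of u_i(z).                                                           *)
Record game (R : realType) (n : nat) := Game {
  act : finType;
  hist : seq (seq act);
  hist_nil : [::] \in hist;
  hist_rcons : forall h a, rcons h a \in hist -> h \in hist;
  owner : seq_sub hist -> option 'I_n;
  infosets : 'I_n -> {set {set seq_sub hist}};
  infosets_partition : forall i,
    partition (infosets i) [set v | ~~ tree_leaf v & owner v == Some i];
  infosets_acts : forall i I, I \in infosets i ->
    {in I &, forall v w, tree_acts v = tree_acts w};
  payoff : 'I_n -> tree_leaves hist -> R }.

Notation node G := (seq_sub (hist G)).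
Notation leaf G := (tree_leaves (hist G)).

Record infoset (R : realType) n (G : game R n) (i : 'I_n) := Infoset {
  infoset_nodes : {set node G};
  infoset_nodesP : infoset_nodes \in infosets G i }.

HB.instance Definition _ (R : realType) n (G : game R n) (i : 'I_n) :=
  [isSub for @infoset_nodes R n G i].
HB.instance Definition _ (R : realType) n (G : game R n) (i : 'I_n) :=
  [Finite of infoset G i by <:].

(* A_I: by infosets_acts the union is over equal sets. *)
Definition infoset_acts (R : realType) n (G : game R n) i
    (I : infoset G i) : {set act G} :=
  \bigcup_(v in infoset_nodes I) tree_acts v.

Record nesq (R : realType) n (G : game R n) (i : 'I_n) := NESq {
  nesq_pair : infoset G i * act G;
  nesq_pairP : nesq_pair.2 \in infoset_acts nesq_pair.1 }.

HB.instance Definition _ (R : realType) n (G : game R n) (i : 'I_n) :=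
  [isSub for @nesq_pair R n G i].
HB.instance Definition _ (R : realType) n (G : game R n) (i : 'I_n) :=
  [Finite of nesq G i by <:].

(* Sigma_i; None is the empty sequence. *)
Definition sq (R : realType) n (G : game R n) (i : 'I_n) : finType :=
  option (nesq G i).

Definition sq_info (R : realType) n (G : game R n) i (p : nesq G i) :
  infoset G i := (nesq_pair p).1.
Definition sq_act (R : realType) n (G : game R n) i (p : nesq G i) :
  act G := (nesq_pair p).2.

(* p = (I, a) is taken, at depth k, on the path from the root to v. *)
Definition taken_at (R : realType) n (G : game R n) i (v : node G) (k : nat)
    (p : nesq G i) : bool :=
  [exists u in infoset_nodes (sq_info p),
     (size (val u) == k) && prefix (rcons (val u) (sq_act p)) (val v)].

(* The pairs (I, a) of Player i encountered on the path from the root to v,  *)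
(* in the order of the path.                                                 *)
Definition own_history (R : realType) n (G : game R n) i (v : node G) :
    seq (nesq G i) :=
  pmap (fun k => [pick p | taken_at v k p]) (iota 0 (size (val v))).

Definition perfect_recall (R : realType) n (G : game R n) : Prop :=
  forall (i : 'I_n) (I : infoset G i),
    {in infoset_nodes I &, forall v w : node G, own_history i v = own_history i w}.

Definition last_sq (R : realType) n (G : game R n) i (v : node G) : sq G i :=
  last None (map Some (own_history i v)).

(* sigma_i(I) = sigma_i(v) for any v in I; see parent_sqE. *)
Definition parent_sq (R : realType) n (G : game R n) i (I : infoset G i) :
    sq G i :=
  if [pick v in infoset_nodes I] is Some v then last_sq i v else None.

Definition connected (R : realType) n (G : game R n) i j
    (I : infoset G i) (J : infoset G j) : bool :=
  [exists u in infoset_nodes I, exists v in infoset_nodes J,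
     prefix (val v) (val u) || prefix (val u) (val v)].

Definition relevant (R : realType) n (G : game R n) i j
    (s : sq G i) (t : sq G j) : bool :=
  match s, t with
  | Some p, Some q => connected (sq_info p) (sq_info q)
  | _, _ => true
  end.

Definition pairwise_relevant (R : realType) n (G : game R n)
    (s : {dffun forall i, sq G i}) : bool :=
  [forall i, forall j, (i != j) ==> relevant (s i) (s j)].

Record reltuple (R : realType) n (G : game R n) := RelTuple {
  reltuple_fun : {dffun forall i, sq G i};
  reltuple_funP : pairwise_relevant reltuple_fun }.

HB.instance Definition _ (R : realType) n (G : game R n) :=
  [isSub for @reltuple_fun R n G].
HB.instance Definition _ (R : realType) n (G : game R n) :=
  [Finite of reltuple G by <:].

(* (sigma_1(z), ..., sigma_{i-1}(z), s, sigma_{i+1}(z), ..., sigma_n(z)) *)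
Definition dev_tuple (R : realType) n (G : game R n) i (s : sq G i)
    (z : leaf G) : {dffun forall j, sq G j} :=
  [ffun j => dfwith (fun k => last_sq k (leaf_node z)) s j].

(* Reduced-normal-form plans: f I = Some a when action a is selected at I,   *)
(* and f I = None when nothing is selected at I.                             *)

Definition plan_reaches (R : realType) n (G : game R n) i
    (f : {ffun infoset G i -> option (act G)}) (I : infoset G i) : bool :=
  [exists v in infoset_nodes I,
     all (fun p => f (sq_info p) == Some (sq_act p)) (own_history i v)].

Definition is_plan (R : realType) n (G : game R n) i
    (f : {ffun infoset G i -> option (act G)}) : bool :=
  [forall I, if f I is Some a then plan_reaches f I && (a \in infoset_acts I)
             else ~~ plan_reaches f I].

Record plan (R : realType) n (G : game R n) (i : 'I_n) := Plan {
  plan_fun : {ffun infoset G i -> option (act G)};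
  plan_funP : is_plan plan_fun }.

HB.instance Definition _ (R : realType) n (G : game R n) (i : 'I_n) :=
  [isSub for @plan_fun R n G i].
HB.instance Definition _ (R : realType) n (G : game R n) (i : 'I_n) :=
  [Finite of plan G i by <:].

Definition profile (R : realType) n (G : game R n) : finType :=
  {dffun forall i, plan G i}.

(* Pi_i(s).  The recursion is on the length of the chain s, sigma_i(I), ..., *)
(* which is at most the number of information sets; see plans_Some.          *)
Fixpoint plans_rec (R : realType) n (G : game R n) i (m : nat) (s : sq G i) :
    {set plan G i} :=
  match m, s with
  | m'.+1, Some p =>
      plans_rec m' (parent_sq (sq_info p))
        :&: [set pi | plan_fun pi (sq_info p) == Some (sq_act p)]
  | _, _ => setT
  end.

Definition plans (R : realType) n (G : game R n) i (s : sq G i) :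
    {set plan G i} :=
  plans_rec #|{: infoset G i}| s.

Definition plans_leaf (R : realType) n (G : game R n) i (z : leaf G) :
    {set plan G i} :=
  plans (last_sq i (leaf_node z)).

Definition distribution (R : realType) (T : finType) (mu : {ffun T -> R}) :
    Prop :=
  (forall x, 0 <= mu x) /\ \sum_x mu x = 1.

(* Vectors and matrices indexed by a finite type T have dimension #|T|, the  *)
(* coordinate of x : T being enum_rank x.                                    *)
Definition corr_vec (R : realType) n (G : game R n) := 'cV[R]_#|{: reltuple G}|.

Definition induced (R : realType) n (G : game R n)
    (mu : {ffun profile G -> R}) : corr_vec G :=
  \col_k \sum_(pi : profile G |
            [forall i, pi i \in plans (reltuple_fun (enum_val k) i)]) mu pi.

Definition Xi (R : realType) n (G : game R n) (xi : corr_vec G) : Prop :=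
  exists mu : {ffun profile G -> R}, distribution mu /\ xi = induced mu.

(* The utility u-hat_i of deviating to muhat. *)
Definition deviation_utility (R : realType) n (G : game R n) i
    (mu : {ffun profile G -> R}) (muhat : {ffun plan G i -> R}) : R :=
  \sum_(z : leaf G) payoff i z
    * (\sum_(pi : profile G |
          [forall j, (j != i) ==> (pi j \in plans_leaf j z)]) mu pi)
    * (\sum_(pi in plans_leaf i z) muhat pi).

(* The utility u_i of committing to the recommendations. *)
Definition commit_utility (R : realType) n (G : game R n) (i : 'I_n)
    (mu : {ffun profile G -> R}) : R :=
  \sum_(z : leaf G) payoff i z
    * \sum_(pi : profile G | [forall j, pi j \in plans_leaf j z]) mu pi.

Definition nfcce (R : realType) n (G : game R n) (mu : {ffun profile G -> R}) :
    Prop :=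
  distribution mu /\
  forall (i : 'I_n) (muhat : {ffun plan G i -> R}), distribution muhat ->
    deviation_utility mu muhat <= commit_utility i mu.

Definition nfcce_plan (R : realType) n (G : game R n) (xi : corr_vec G) :
    Prop :=
  exists mu : {ffun profile G -> R}, nfcce mu /\ xi = induced mu.

Definition F_mx (R : realType) n (G : game R n) i :
    'M[R]_(1 + #|{: infoset G i}|, #|{: sq G i}|) :=
  col_mx
    (\row_l ((enum_val l : sq G i) == None)%:R)
    (\matrix_(k, l)
       ((if (enum_val l : sq G i) is Some p
         then (sq_info p == enum_val k)%:R else 0)
        - ((enum_val l : sq G i) == parent_sq (enum_val k))%:R)).

Definition f_vec (R : realType) n (G : game R n) i :
    'cV[R]_(1 + #|{: infoset G i}|) :=
  col_mx 1 0.

Definition A_mx (R : realType) n (G : game R n) i :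
    'M[R]_(#|{: reltuple G}|, #|{: sq G i}|) :=
  \matrix_(k, l) \sum_(z : leaf G)
    payoff i z * (reltuple_fun (enum_val k) == dev_tuple (None : sq G i) z)%:R
      * ((enum_val l : sq G i) == last_sq i (leaf_node z))%:R.

Definition b_vec (R : realType) n (G : game R n) i : 'cV[R]_#|{: reltuple G}| :=
  \col_k \sum_(z : leaf G)
    payoff i z
      * (reltuple_fun (enum_val k) == dev_tuple (last_sq i (leaf_node z)) z)%:R.

(* xi_i(s; z).  The default 0 only concerns tuples that are not pairwise     *)
(* relevant; see dev_tuple_None_relevant and dev_tuple_last_relevant.        *)
Definition xi_at (R : realType) n (G : game R n) (xi : corr_vec G) i
    (s : sq G i) (z : leaf G) : R :=
  if insub (dev_tuple s z) is Some t
  then xi (enum_rank (t : reltuple G)) 0 else 0.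

Definition lp_constraints (R : realType) n (G : game R n) (xi : corr_vec G)
    (u : R) (v : forall i : 'I_n, 'cV[R]_(1 + #|{: infoset G i}|)) : Prop :=
  forall i : 'I_n,
    0 <= u - ((v i)^T *m f_vec G i) 0 0 + ((b_vec G i)^T *m xi) 0 0 /\
    forall l, 0 <= ((F_mx G i)^T *m v i - (A_mx G i)^T *m xi) l 0.

Definition nfcce_lp_feasible (R : realType) n (G : game R n) (xi : corr_vec G)
    (u : R) (v : forall i : 'I_n, 'cV[R]_(1 + #|{: infoset G i}|)) : Prop :=
  [/\ lp_constraints xi u v, u <= 0 & Xi xi].

Definition nfcce_lp_optimal (R : realType) n (G : game R n) (c : corr_vec G)
    (xi : corr_vec G) (u : R)
    (v : forall i : 'I_n, 'cV[R]_(1 + #|{: infoset G i}|)) : Prop :=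
  nfcce_lp_feasible xi u v /\
  forall (xi' : corr_vec G) (u' : R)
         (v' : forall i : 'I_n, 'cV[R]_(1 + #|{: infoset G i}|)),
    nfcce_lp_feasible xi' u' v' -> (c^T *m xi') 0 0 <= (c^T *m xi) 0 0.

Definition is_minimum (R : realType) (S : R -> Prop) (w : R) : Prop :=
  S w /\ forall x, S x -> w <= x.
Definition is_maximum (R : realType) (S : R -> Prop) (w : R) : Prop :=
  S w /\ forall x, S x -> x <= w.

Lemma parent_sqE (R : realType) n (G : game R n) i (I : infoset G i)
    (v : node G) :
  perfect_recall G -> v \in infoset_nodes I -> parent_sq I = last_sq i v.
Proof.
move=> PR vI; rewrite /parent_sq; case: pickP => [w wI|/(_ v)]; last by rewrite vI.
by rewrite /last_sq (PR i I w v).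
Qed.

Lemma plans_recS (R : realType) n (G : game R n) i m (p : nesq G i) :
  perfect_recall G ->
  plans_rec m.+1 (Some p) = [set pi | plan_fun pi (sq_info p) == Some (sq_act p)].
Proof.
move=> PR; elim: m p => [|m IH] p; first by rewrite /= setTI.
rewrite -[LHS]/(plans_rec m.+1 (parent_sq (sq_info p)) :&: _).
case Es: (parent_sq (sq_info p)) => [q|]; last by rewrite /= setTI.
rewrite IH; apply/setIidPr/subsetP => -[f fP]; rewrite !inE /= => /eqP E.
have := forallP fP (sq_info p); rewrite E => /andP[/exists_inP[v vI Hv] _].
move: Es Hv; rewrite (parent_sqE PR vI) /last_sq.
case/lastP: (own_history i v) => [//|s r].
by rewrite all_rcons map_rcons last_rcons => -[->] /andP[].
Qed.

Lemma plans_None (R : realType) n (G : game R n) (i : 'I_n) :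
  plans (None : sq G i) = setT.
Proof. by rewrite /plans; case: #|_|. Qed.

Lemma plans_Some (R : realType) n (G : game R n) (i : 'I_n) (p : nesq G i) :
  perfect_recall G ->
  plans (Some p) = plans (parent_sq (sq_info p))
                     :&: [set pi | plan_fun pi (sq_info p) == Some (sq_act p)].
Proof.
move=> PR; rewrite /plans.
have : (0 < #|{: infoset G i}|)%N by apply/card_gt0P; exists (sq_info p).
case: #|_| => // m _; rewrite -[RHS]/(plans_rec m.+2 (Some p)).
by rewrite !plans_recS.
Qed.

Lemma last_sq_taken (R : realType) n (G : game R n) i (v : node G)
    (p : nesq G i) :
  last_sq i v = Some p -> exists2 u : node G, u \in infoset_nodes (sq_info p) &
    prefix (val u) (val v).
Proof.
move=> E; have : p \in own_history i v.
  move: E; rewrite /last_sq; case/lastP: (own_history i v) => [//|s q].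
  by rewrite map_rcons last_rcons => -[->]; rewrite mem_rcons mem_head.
rewrite /own_history mem_pmap => /mapP[k _]; case: pickP => // q + [->].
move=> /exists_inP[u uI /andP[_ Hu]]; exists u => //.
exact: prefix_trans (prefix_rcons _ _) Hu.
Qed.

Lemma last_sq_relevant (R : realType) n (G : game R n) i j (v : node G) :
  relevant (last_sq (G := G) i v) (last_sq (G := G) j v).
Proof.
case Ei: (last_sq i v) => [p|] //; case Ej: (last_sq j v) => [q|] //=.
have [u uI pu] := last_sq_taken Ei; have [w wJ pw] := last_sq_taken Ej.
apply/exists_inP; exists u => //; apply/exists_inP; exists w => //.
move: pu pw; rewrite !prefixE => /eqP pu /eqP pw.
case/orP: (leq_total (size (val u)) (size (val w))) => h; apply/orP.
  by right; rewrite -[X in take _ X]pw take_takel // pu.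
by left; rewrite -[X in take _ X]pu take_takel // pw.
Qed.

Lemma dev_tuple_last_relevant (R : realType) n (G : game R n) (i : 'I_n)
    (z : leaf G) :
  pairwise_relevant (dev_tuple (last_sq i (leaf_node z)) z).
Proof.
apply/forallP => j; apply/forallP => k; apply/implyP => _; rewrite !ffunE.
by case: dfwithP => [|j' _]; case: dfwithP => [|k' _]; apply: last_sq_relevant.
Qed.

Lemma dev_tuple_None_relevant (R : realType) n (G : game R n) (i : 'I_n)
    (z : leaf G) :
  pairwise_relevant (dev_tuple (None : sq G i) z).
Proof.
apply/forallP => j; apply/forallP => k; apply/implyP => _; rewrite !ffunE.
case: dfwithP => [//|j' _]; case: dfwithP => [|k' _].
  by case: (last_sq j' _).
exact: last_sq_relevant.
Qed.

Lemma sum_xi_at (R : realType) n (G : game R n) (xi : corr_vec G) i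
    (s : sq G i) (z : leaf G) :
  \sum_k xi k 0 * (reltuple_fun (enum_val k) == dev_tuple s z)%:R
  = xi_at xi s z.
Proof.
rewrite /xi_at; case: insubP => [t _ tE|nP].
  rewrite (bigD1 (enum_rank t)) //= enum_rankK tE eqxx mulr1 big1 ?addr0 // => k.
  move=> nk; rewrite -tE (inj_eq val_inj); case: eqP => [kt|_]; last by rewrite mulr0.
  by case/eqP: nk; rewrite -kt enum_valK.
apply: big1 => k _; case: eqP => [kt|_]; last by rewrite mulr0.
by case/negP: nP; rewrite -kt (valP (enum_val k)).
Qed.

Lemma A_mxE (R : realType) n (G : game R n) (i : 'I_n) (xi : corr_vec G)
    (y : 'cV[R]_#|{: sq G i}|) :
  (xi^T *m A_mx G i *m y) 0 0
  = \sum_(z : leaf G) payoff i z * xi_at xi (None : sq G i) z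
                        * y (enum_rank (last_sq i (leaf_node z))) 0.
Proof.
rewrite mxE.
under eq_bigr => l _.
  rewrite mxE; under eq_bigr => k _ do rewrite !mxE mulr_sumr.
  rewrite exchange_big /= mulr_suml; over.
rewrite exchange_big; apply: eq_bigr => z _ /=.
rewrite (bigD1 (enum_rank (last_sq i (leaf_node z)))) //=.
rewrite [X in _ + X]big1 ?addr0.
  congr (_ * _); rewrite -sum_xi_at mulr_sumr; apply: eq_bigr => k _.
  by rewrite enum_rankK eqxx mulr1 mulrCA.
move=> l nl; rewrite big1 ?mul0r // => k _.
case: (enum_val l =P _) => [el|_]; last by rewrite !mulr0.
by case/eqP: nl; rewrite -el enum_valK.
Qed.

Lemma b_vecE (R : realType) n (G : game R n) (i : 'I_n) (xi : corr_vec G) :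
  ((b_vec G i)^T *m xi) 0 0
  = \sum_(z : leaf G) payoff i z * xi_at xi (last_sq i (leaf_node z)) z.
Proof.
rewrite mxE; under eq_bigr => k _ do rewrite !mxE mulr_suml.
rewrite exchange_big; apply: eq_bigr => z _ /=.
by rewrite -sum_xi_at mulr_sumr; apply: eq_bigr => k _; rewrite mulrAC mulrA.
Qed.

Lemma F_mxE (R : realType) n (G : game R n) (i : 'I_n)
    (y : 'cV[R]_#|{: sq G i}|) :
  F_mx G i *m y = f_vec G i <->
  y (enum_rank (None : sq G i)) 0 = 1 /\
  forall I : infoset G i,
    \sum_(p : nesq G i | sq_info p == I) y (enum_rank (Some p : sq G i)) 0
      - y (enum_rank (parent_sq I)) 0 = 0.
Proof.
have sumE (s : sq G i) :
    \sum_l ((enum_val l : sq G i) == s)%:R * y l 0 = y (enum_rank s) 0.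
  rewrite (bigD1 (enum_rank s)) //= enum_rankK eqxx mul1r big1 ?addr0 // => l nl.
  case: eqP => [el|_]; last by rewrite mul0r.
  by case/eqP: nl; rewrite -el enum_valK.
have sum_optE (g : sq G i -> R) : g None = 0 -> \sum_s g s = \sum_p g (Some p).
  move=> g0; rewrite (bigD1 None) //= g0 add0r (reindex_omap Some id) /=.
    by apply: eq_bigl => p; rewrite eqxx.
  by case.
have FE (k : 'I_#|{: infoset G i}|) :
    (dsubmx (F_mx G i *m y)) k 0 =
    \sum_(p : nesq G i | sq_info p == enum_val k) y (enum_rank (Some p : sq G i)) 0
      - y (enum_rank (parent_sq (enum_val k))) 0.
  rewrite mul_col_mx col_mxKd mxE -sumE.
  under eq_bigr => l _ do rewrite mxE mulrBl.
  rewrite sumrB; congr (_ - _).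
  rewrite (reindex (@enum_rank (sq G i))) /=; last first.
    by exists enum_val => s _; rewrite ?enum_valK ?enum_rankK.
  rewrite sum_optE ?enum_rankK ?mul0r // [RHS]big_mkcond; apply: eq_bigr => p _.
  by rewrite enum_rankK; case: eqP; rewrite ?mul1r ?mul0r.
have F0 : (usubmx (F_mx G i *m y)) 0 0 = y (enum_rank (None : sq G i)) 0.
  rewrite mul_col_mx col_mxKu mxE -sumE.
  by apply: eq_bigr => l _; rewrite mxE.
split=> [E|[y0 yI]].
  split=> [|I]; first by rewrite -F0 E col_mxKu mxE.
  by have := FE (enum_rank I); rewrite E col_mxKd mxE enum_rankK => <-.
rewrite -[LHS]vsubmxK /f_vec; congr col_mx.
  by apply/matrixP => k l; rewrite !ord1 F0 y0 mxE.
by apply/matrixP => k l; rewrite !ord1 FE yI mxE.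
Qed.

(* Main.v *)
Require Import Defs.
From mathcomp Require Import all_boot all_order all_algebra.
From mathcomp Require Import reals lra.

(* A deviation enters the deviation utility only through its sequence-form    *)
(* realization, which satisfies F y = f; hence v_i^T f_i bounds the deviation *)
(* utility for every dual-feasible v_i.  The bound is attained by backward    *)
(* induction: the optimal values of the information sets form a dual-feasible *)
(* vector that is tight along the pure plan playing a best action everywhere. *)
(* Thus the feasible points of the second program are exactly the NFCCE       *)
(* plans.  They exist and a best one exists because both failures are         *)
(* excluded by a Farkas-type alternative on the simplex of distributions over *)
(* plan profiles; for existence the certificate is refuted by a product       *)
(* distribution, as in Hart and Schmeidler.                                   *)

Set Implicit Arguments.
Unset Strict Implicit.
Unset Printing Implicit Defensive.

Import Order.TTheory GRing.Theory Num.Theory.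
Local Open Scope ring_scope.

(** For fixed [xi] the players share only [u], so the minimum is the largest over [i] of the least
    feasible [v_i^T f_i] minus [b_i^T xi]. That least value is LP-dual to maximizing [xi^T A_i y]
    over [F_i y = f_i], [y >= 0]. [lp_duality_gapE] writes the duality gap as dual slack paired with
    a realization: nonnegativity gives weak duality, and [player_lp_optimum] exhibits a dual vector
    and a pure plan for which the gap vanishes. Both are combined in [benefit_lp_value].

    Requiring [u <= 0] then says that no deviation gains, so the second program maximizes over NFCCE
    plans. Its solvability is shown in the coordinates [mu]: by [nfcceP] the NFCCEs are cut out of a
    simplex by finitely many homogeneous inequalities, [nfcce_exists] shows this set nonempty, and
    [simplex_lp_attained] supplies a maximizer. *)

(** * Theorems of the alternative and linear optimization on a simplex *)

(* Bartl's induction on the number of functionals. *)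
Lemma farkas_ord (R : realFieldType) (X : finType) m (a : 'I_m -> X -> R)
    (g : X -> R) :
  (exists2 x : X -> R, forall i, \sum_j a i j * x j <= 0 &
                       0 < \sum_j g j * x j) \/
  (exists2 l : 'I_m -> R, forall i, 0 <= l i &
                          forall j, g j = \sum_i l i * a i j).
Proof.
elim: m a g => [|m IH] a g.
  case: (pickP (fun j => g j != 0)) => [j gj|g0].
    left; exists g => [[]//|]; rewrite (bigD1 j) //=.
    rewrite ltr_wpDr ?sumr_ge0 // => [k _|]; first by rewrite -expr2 sqr_ge0.
    by rewrite lt_def mulf_neq0 // -expr2 sqr_ge0.
  by right; exists (fun _ => 0) => // j; rewrite big_ord0; apply/eqP/negbFE/g0.
pose ext (c : R) (l : 'I_m -> R) i := oapp l c (unlift ord0 i).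
have ext_ge0 c l : 0 <= c -> (forall i, 0 <= l i) -> forall i, 0 <= ext c l i.
  by move=> c0 l0 i; rewrite /ext; case: unliftP => /=.
have sum_ext c l j : \sum_i ext c l i * a i j =
    c * a ord0 j + \sum_i l i * a (lift ord0 i) j.
  rewrite big_ord_recl /ext unlift_none; congr (_ + _).
  by apply: eq_bigr => i _; rewrite liftK.
case: (IH (fun i => a (lift ord0 i)) g) => [[x0 ax0 gx0]|[l l0 gl]]; last first.
  by right; exists (ext 0 l) => [|j]; [apply: ext_ge0|rewrite sum_ext mul0r add0r].
set k := \sum_j a ord0 j * x0 j.
case: (lerP k 0) => [k_le0|k_gt0].
  by left; exists x0 => // i; case: (unliftP ord0 i) => [i'|] ->.
(* [x0] violates the first inequality only. [red f] is [f] composed with the projection along [x0]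
   onto the kernel of [a ord0]; [y] below is the projection of [x]. *)
pose red (f : X -> R) j := f j - (\sum_j f j * x0 j) / k * a ord0 j.
case: (IH (fun i => red (a (lift ord0 i))) (red g)) => [[x ax gx]|[l l0 gl]].
  pose y j := x j - (\sum_j a ord0 j * x j) / k * x0 j.
  have yE f : \sum_j f j * y j =
      \sum_j f j * x j - (\sum_j a ord0 j * x j) / k * \sum_j f j * x0 j.
    rewrite mulr_sumr -sumrB; apply: eq_bigr => j _.
    by rewrite mulrBr mulrCA.
  have redE f : \sum_j red f j * x j = \sum_j f j * y j.
    under eq_bigr do rewrite mulrBl -(mulrA _ (a ord0 _)).
    by rewrite sumrB -mulr_sumr yE mulrAC [in RHS]mulrAC [in RHS](mulrC (\sum_j _)).
  left; exists y => [i|]; last by rewrite -redE.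
  case: (unliftP ord0 i) => [i'|] ->; first by rewrite -redE.
  by rewrite yE -/k divfK ?gt_eqF // subrr.
(* Undoing the reduction collects the [x0] terms in the coefficient of [a ord0]; it is nonnegative
   since at [x0] the functional [g] is positive and the remaining ones are nonpositive. *)
right; exists (ext ((\sum_j g j * x0 j) / k -
                    \sum_i l i * ((\sum_j a (lift ord0 i) j * x0 j) / k)) l).
  apply: ext_ge0 => //; rewrite subr_ge0 (@le_trans _ _ 0) //.
    apply: sumr_le0 => i _; rewrite mulr_ge0_le0 // mulr_le0_ge0 //.
    by rewrite invr_ge0 ltW.
  by rewrite divr_ge0 // ltW.
move=> j; have /eqP := gl j; rewrite subr_eq => /eqP ->.
under eq_bigr do rewrite mulrBr (mulrA _ _ (a ord0 j)).
by rewrite sumrB -mulr_suml sum_ext mulrBl addrC addrCA addrC.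
Qed.

Lemma farkas (R : realFieldType) (T X : finType) (a : T -> X -> R) (g : X -> R) :
  (exists2 x : X -> R, forall t, \sum_j a t j * x j <= 0 &
                       0 < \sum_j g j * x j) \/
  (exists2 l : T -> R, forall t, 0 <= l t &
                       forall j, g j = \sum_t l t * a t j).
Proof.
case: (farkas_ord (fun k => a (@enum_val T predT k)) g) => [[x ax gx]|[l l0 gl]].
  by left; exists x => // t; rewrite -[t]enum_rankK.
right; exists (l \o enum_rank) => [t|j] /=; first exact: l0.
rewrite gl (reindex enum_rank) /=; last by exists enum_val => ? _; rewrite ?enum_valK ?enum_rankK.
by apply: eq_bigr => t _; rewrite enum_rankK.
Qed.

Lemma simplex_alternative (R : realType) (T X : finType) (M : T -> X -> R) :
  (exists2 x : {ffun X -> R}, distribution x &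
                              forall t, \sum_j M t j * x j <= 0) \/
  (exists2 l : T -> R, forall t, 0 <= l t &
                       forall j, 1 <= \sum_t l t * M t j).
Proof.
pose a (t : T + X) j := match t with inl t => M t j | inr i => - (i == j)%:R end.
case: (farkas a (fun=> 1)) => [[x ax]|[l l0 gl]]; last first.
  right; exists (l \o inl) => [t|j]; first exact: l0.
  rewrite [X in X <= _](gl j) big_sumType /= gerDl sumr_le0 // => i _.
  by rewrite mulrN oppr_le0 mulr_ge0 ?ler0n.
under eq_bigr do rewrite mul1r; set s := \sum_j x j => s_gt0.
left; exists [ffun j => x j / s]; first split=> [j|].
- rewrite ffunE divr_ge0 ?(ltW s_gt0) //; have := ax (inr j).
  rewrite (bigD1 j) //= eqxx mulN1r big1 ?addr0 ?oppr_le0 // => i.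
  by rewrite eq_sym => /negPf->; rewrite oppr0 mul0r.
- by under eq_bigr do rewrite ffunE; rewrite -mulr_suml divff ?gt_eqF.
- move=> t; under eq_bigr do rewrite ffunE mulrA.
  by rewrite -mulr_suml mulr_le0_ge0 ?invr_ge0 ?(ltW s_gt0) //; apply: (ax (inl t)).
Qed.

(** Add a row [None] demanding that the objective reach its supremum. A certificate against the
    enlarged system, averaged over any feasible [x], keeps the objective at least [(l None)^-1]
    below the supremum, which is absurd. *)
Lemma simplex_lp_attained (R : realType) (T X : finType) (M : T -> X -> R)
    (c : X -> R) (feasible : {ffun X -> R} -> Prop) :
  (forall x, feasible x <->
     distribution x /\ forall t, \sum_j M t j * x j <= 0) ->
  (exists x, feasible x) ->
  exists2 x, feasible x &
    forall y, feasible y -> \sum_j c j * y j <= \sum_j c j * x j.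
Proof.
move=> feasP [x0 fx0].
pose S (r : R) := exists2 x, feasible x & r = \sum_j c j * x j.
have Sub x : feasible x -> \sum_j c j * x j <= sup S.
  move=> fx; apply: ub_le_sup; last by exists x.
  exists (\sum_j `|c j|) => _ [y /feasP[[y0 y1] _] ->]; apply: ler_sum => j _.
  apply: le_trans (ler_norm _) _; rewrite normrM (ger0_norm (y0 j)) ler_piMr //.
  by rewrite -y1 (bigD1 j) //= lerDl sumr_ge0.
pose M' t j := if t is Some t' then M t' j else sup S - c j.
have gapE (x : {ffun X -> R}) : distribution x ->
    \sum_j M' None j * x j = sup S - \sum_j c j * x j.
  case=> _ x1; under eq_bigr do rewrite mulrBl.
  by rewrite sumrB -mulr_sumr x1 mulr1.
case: (simplex_alternative M') => [[x dx Mx]|[l l0 lM]].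
  have fx : feasible x by apply/feasP; split=> // t; apply: (Mx (Some t)).
  exists x => // y /Sub/le_trans; apply.
  by have := Mx None; rewrite gapE // subr_le0.
have gap x : feasible x -> 1 <= l None * (sup S - \sum_j c j * x j).
  case/feasP => -[x0' x1] Mx; rewrite -gapE // -[1]x1.
  apply: (@le_trans _ _ (\sum_t l t * \sum_j M' t j * x j)).
    under [leRHS]eq_bigr do rewrite mulr_sumr.
    rewrite exchange_big; apply: ler_sum => j _ /=.
    under eq_bigr do rewrite mulrA.
    by rewrite -mulr_suml ler_peMl.
  rewrite (bigD1 None) //= gerDl sumr_le0 // => -[t|] // _.
  by rewrite mulr_ge0_le0 //; apply: Mx.
have l_gt0 : 0 < l None.
  rewrite lt_def l0 andbT; apply: contraTneq (gap _ fx0) => ->.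
  by rewrite mul0r ler10.
suff : sup S <= sup S - (l None)^-1.
  by rewrite lerDl oppr_ge0 invr_le0 leNgt l_gt0.
apply: ge_sup => [|_ [x fx ->]]; first by exists (\sum_j c j * x0 j), x0.
by rewrite lerBrDl -lerBrDr -[_^-1]mul1r ler_pdivrMr // mulrC gap.
Qed.

(** * Point masses *)

Definition dirac (R : realType) (T : finType) (x0 : T) : {ffun T -> R} :=
  [ffun x => (x == x0)%:R].

Lemma distribution_dirac (R : realType) (T : finType) (x0 : T) :
  distribution (dirac R x0).
Proof.
split=> [x|]; first by rewrite ffunE ler0n.
rewrite (bigD1 x0) //= ffunE eqxx big1 ?addr0 // => x /negPf nx.
by rewrite ffunE nx.
Qed.

Lemma sum_dirac (R : realType) (T : finType) (x0 : T) (P : pred T) :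
  \sum_(x | P x) dirac R x0 x = (P x0)%:R.
Proof.
rewrite big_mkcond (bigD1 x0) //= ffunE eqxx big1 ?addr0 => [|x /negPf nx].
  by case: (P x0).
by rewrite ffunE nx; case: (P x).
Qed.

Lemma sum_dirac_mull (R : realType) (T : finType) (x0 : T) (F : T -> R) :
  \sum_x dirac R x0 x * F x = F x0.
Proof.
rewrite (bigD1 x0) //= ffunE eqxx mul1r big1 ?addr0 // => x /negPf nx.
by rewrite ffunE nx mul0r.
Qed.

(** * Own histories and pure plans *)

Lemma pmap_iota_rcons (T : Type) (f : nat -> option T) m s p :
  pmap f (iota 0 m) = rcons s p ->
  exists k, [/\ (k < m)%N, f k = Some p & pmap f (iota 0 k) = s].
Proof.
elim: m => [|m IH]; first by case: s.
rewrite -[in iota _ _]addn1 iotaD pmap_cat add0n /=.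
case fm: (f m) => [q|] /=; last first.
  by rewrite cats0 => /IH[k [km fk sk]]; exists k; rewrite ltnW.
by rewrite cats1 => /rcons_inj[<- <-]; exists m; rewrite ltnSn fm.
Qed.

Lemma taken_at_prefix (R : realType) n (G : game R n) i (u v : node G) k
    (p : nesq G i) :
  prefix (val u) (val v) -> (k < size (val u))%N ->
  taken_at v k p = taken_at u k p.
Proof.
move=> /prefixP[t vE] ku; apply: eq_existsb => w; congr (_ && _).
case: eqP => //= wk; rewrite vE !prefixE size_rcons wk takel_cat //.
Qed.

(** The witness is the node where [p] was taken: entries at smaller depths depend only on the path
    up to it. This drives inductions along a player's own moves. *)
Lemma own_history_rcons (R : realType) n (G : game R n) i (v : node G) s
    (p : nesq G i) :
  own_history i v = rcons s p ->
  exists2 u : node G, u \in infoset_nodes (sq_info p) & own_history i u = s.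
Proof.
move=> hv; have [k [kv vk <-]] := pmap_iota_rcons hv; move: vk.
 case: pickP => // q qk [qp]; move: qk; rewrite {}qp.
case/exists_inP => u uI /andP[/eqP uk puv]; exists u => //.
rewrite /own_history uk; apply/eq_in_pmap => j; rewrite mem_iota add0n => jk.
apply: eq_pick => r; apply/esym/taken_at_prefix; last by rewrite uk.
exact: prefix_trans (prefix_rcons _ _) puv.
Qed.

Lemma nesq_eq (R : realType) n (G : game R n) i (p q : nesq G i) :
  sq_info p = sq_info q -> sq_act p = sq_act q -> p = q.
Proof.
move=> eI ea; apply: val_inj; rewrite /= [LHS]surjective_pairing.
by rewrite -[_.1]/(sq_info p) -[_.2]/(sq_act p) eI ea -surjective_pairing.
Qed.

Lemma infoset_neq0 (R : realType) n (G : game R n) i (I : infoset G i) :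
  exists v, v \in infoset_nodes I.
Proof.
case/and3P: (infosets_partition G i) => _ _ /negP I0.
apply/set0Pn/eqP => E; apply: I0; rewrite -E; exact: infoset_nodesP.
Qed.

Lemma infoset_sq (R : realType) n (G : game R n) i (I : infoset G i) :
  exists p : nesq G i, sq_info p = I.
Proof.
have [v vI] := infoset_neq0 I.
have : v \in cover (infosets G i).
  by apply/bigcupP; exists (infoset_nodes I) => //; exact: infoset_nodesP.
rewrite (cover_partition (infosets_partition G i)) inE => /andP[/set0Pn[a av] _].
have aI : a \in infoset_acts I by apply/bigcupP; exists v.
by exists (@NESq R n G i (I, a) aI).
Qed.

(** A choice at every information set becomes a reduced plan once it is erased at the sets that
    following [b] does not reach. *)
Lemma plan_of_choice (R : realType) n (G : game R n) i
    (b : infoset G i -> nesq G i) :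
  (forall I, sq_info (b I) = I) ->
  exists pi : plan G i, forall p,
    plan_fun pi (sq_info p) = Some (sq_act p) -> p = b (sq_info p).
Proof.
move=> bI; pose follows := fun p : nesq G i => p == b (sq_info p).
pose f := [ffun I : infoset G i =>
  if [exists v in infoset_nodes I, all follows (own_history i v)]
  then Some (sq_act (b I)) else None].
have fP p : f (sq_info p) = Some (sq_act p) -> follows p.
  rewrite ffunE; case: ifP => // _ [ep]; apply/eqP/nesq_eq; by rewrite ?bI ?ep.
(* The erasure does not alter reachability: along a history that follows [b], each set met is itself
   reached. *)
have fE v : all (fun p => f (sq_info p) == Some (sq_act p)) (own_history i v)
            = all follows (own_history i v).
  apply/idP/idP; first by apply: sub_all => p /eqP/fP.
  move: {2}(own_history i v) (erefl (own_history i v)) => s.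
  elim/last_ind: s v => [|s p IH] v vs; first by rewrite vs.
  rewrite vs !all_rcons => /andP[/eqP pb sb].
  have [u uI us] := own_history_rcons vs.
  rewrite -us IH ?us // andbT ffunE.
  case: exists_inP => [_|[]]; first by rewrite -pb.
  by exists u; rewrite ?us.
suff fplan : is_plan f by exists (Plan fplan) => p /fP/eqP.
apply/forallP => I; have rE : plan_reaches f I =
    [exists v in infoset_nodes I, all follows (own_history i v)].
  by apply: eq_existsb => v; rewrite fE.
rewrite rE [f I]ffunE; case: ifP => // _ /=.
by rewrite -{2}(bI I); exact: (nesq_pairP (b I)).
Qed.

Lemma plan_inhabited (R : realType) n (G : game R n) i : inhabited (plan G i).
Proof.
have [b bI] := fin_all_exists (@infoset_sq R n G i).
by have [pi _] := plan_of_choice bI.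
Qed.

(** The plan selects the last own action before [I], hence reaches the set where it is taken;
    perfect recall carries the earlier actions over to the node on the path to [I]. *)
Lemma plans_parent_reaches (R : realType) n (G : game R n) i (I : infoset G i)
    (pi : plan G i) :
  perfect_recall G -> pi \in plans (parent_sq I) -> plan_reaches (plan_fun pi) I.
Proof.
move=> PR; have [v vI] := infoset_neq0 I; rewrite (parent_sqE PR vI) /last_sq.
move=> pis; apply/exists_inP; exists v => //; move: pis.
case/lastP E: (own_history i v) => [//|s p].
rewrite map_rcons last_rcons plans_Some // !inE all_rcons => /andP[_ pip].
rewrite pip; have [u uI us] := own_history_rcons E.
have := forallP (plan_funP pi) (sq_info p); rewrite (eqP pip) => /andP[+ _].
by case/exists_inP => w wI; rewrite (PR i (sq_info p) w u) // us.
Qed.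

(** * Sequence-form realizations and the matrices of the program *)

Definition realization (R : realType) n (G : game R n) i
    (muhat : {ffun plan G i -> R}) : 'cV[R]_#|{: sq G i}| :=
  \col_l \sum_(pi in plans (enum_val l : sq G i)) muhat pi.

Lemma realization_ge0 (R : realType) n (G : game R n) i
    (muhat : {ffun plan G i -> R}) l :
  distribution muhat -> 0 <= realization muhat l 0.
Proof. by case=> mu0 _; rewrite mxE sumr_ge0. Qed.

(** Plan by plan: one in [plans (parent_sq I)] reaches [I] and selects exactly one action there; any
    other contributes to neither side. *)
Lemma F_mx_realization (R : realType) n (G : game R n) i
    (muhat : {ffun plan G i -> R}) :
  perfect_recall G -> distribution muhat ->
  F_mx G i *m realization muhat = f_vec G i.
Proof.
move=> PR [_ mu1]; apply/F_mxE; split=> [|I].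
  by rewrite mxE enum_rankK plans_None -mu1; apply: eq_bigl => pi; rewrite inE.
apply/eqP; rewrite subr_eq0 mxE enum_rankK; apply/eqP.
under eq_bigr do rewrite mxE enum_rankK big_mkcond.
rewrite exchange_big [RHS]big_mkcond; apply: eq_bigr => pi _ /=.
case: ifPn => [piI|npi]; last first.
  rewrite big1 // => p /eqP pI; rewrite plans_Some // inE pI.
  by rewrite (negPf npi).
have := forallP (plan_funP pi) I; rewrite plans_parent_reaches //.
case piIE: (plan_fun pi I) => [a|] //= aI.
rewrite (bigD1 (@NESq R n G i (I, a) aI)) //= plans_Some // !inE /=.
rewrite /sq_info /sq_act /= piI piIE eqxx /= big1 ?addr0 // => p /andP[/eqP pI np].
rewrite plans_Some // !inE /sq_info pI piI piIE /=.
by case: eqP => // -[ea]; case/eqP: np; apply: nesq_eq.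
Qed.

Lemma xi_at_induced (R : realType) n (G : game R n)
    (mu : {ffun profile G -> R}) i (s : sq G i) (z : leaf G) :
  pairwise_relevant (dev_tuple s z) ->
  xi_at (induced mu) s z =
  \sum_(pi : profile G | [forall j, pi j \in plans (dev_tuple s z j)]) mu pi.
Proof.
move=> rel; rewrite /xi_at; case: insubP => [t _ tE|/negP//].
by rewrite mxE enum_rankK [reltuple_fun t]tE.
Qed.

(** Phrased through a predicate [P] because [s] and the entry at [j] have different types until [j]
    is identified with [i]. *)
Lemma dev_tupleE (R : realType) n (G : game R n) i (s : sq G i) (z : leaf G) j
    (P : forall j, sq G j -> bool) :
  P j (dev_tuple s z j) =
  if j == i then P i s else P j (last_sq j (leaf_node z)).
Proof.
rewrite ffunE; case: dfwithP => [|k nk]; first by rewrite eqxx.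
by rewrite eq_sym (negPf nk).
Qed.

Lemma b_vec_induced (R : realType) n (G : game R n) i
    (mu : {ffun profile G -> R}) :
  ((b_vec G i)^T *m induced mu) 0 0 = commit_utility i mu.
Proof.
rewrite b_vecE; apply: eq_bigr => z _; congr (_ * _).
rewrite xi_at_induced; last exact: dev_tuple_last_relevant.
apply: eq_bigl => pi; apply: eq_forallb => j.
rewrite (dev_tupleE _ _ _ (fun j s => pi j \in plans s)).
by case: eqP => [->|].
Qed.

Lemma A_mx_induced (R : realType) n (G : game R n) i
    (mu : {ffun profile G -> R}) (muhat : {ffun plan G i -> R}) :
  ((induced mu)^T *m A_mx G i *m realization muhat) 0 0 =
  deviation_utility mu muhat.
Proof.
rewrite A_mxE; apply: eq_bigr => z _.
rewrite mxE enum_rankK; congr (_ * _ * _).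
rewrite xi_at_induced; last exact: dev_tuple_None_relevant.
apply: eq_bigl => pi; apply: eq_forallb => j.
rewrite (dev_tupleE _ _ _ (fun j s => pi j \in plans s)).
by case: eqP => // ->; rewrite plans_None inE.
Qed.

(** Substituting [F y = f] for the realization [y] yields weak duality and complementary slackness
    in one identity. *)
Lemma lp_duality_gapE (R : realType) n (G : game R n) i (xi : corr_vec G)
    (v : 'cV[R]_(1 + #|{: infoset G i}|)) (muhat : {ffun plan G i -> R}) :
  perfect_recall G -> distribution muhat ->
  (v^T *m f_vec G i) 0 0 - (xi^T *m A_mx G i *m realization muhat) 0 0 =
  \sum_l ((F_mx G i)^T *m v - (A_mx G i)^T *m xi) l 0 * realization muhat l 0.
Proof.
move=> PR dmu; rewrite -(F_mx_realization PR dmu) mulmxA.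
have -> (w1 w2 : 'M[R]_1) : w1 0 0 - w2 0 0 = (w1 - w2) 0 0 by rewrite !mxE.
rewrite -mulmxBl mxE; apply: eq_bigr => l _; congr (_ * _).
have -> : v^T *m F_mx G i - xi^T *m A_mx G i =
    ((F_mx G i)^T *m v - (A_mx G i)^T *m xi)^T.
  by rewrite linearB /= !trmx_mul !trmxK.
by rewrite mxE.
Qed.

(** * Backward induction and the value of the first program *)

Definition infoset_depth (R : realType) n (G : game R n) i (I : infoset G i) :
    nat :=
  if [pick v in infoset_nodes I] is Some v then size (own_history i v) else 0.

Lemma infoset_depth_child (R : realType) n (G : game R n) i (J : infoset G i)
    (p : nesq G i) :
  perfect_recall G -> parent_sq J = Some p ->
  infoset_depth J = (infoset_depth (sq_info p)).+1.
Proof.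
move=> PR; have depthE (I : infoset G i) v : v \in infoset_nodes I ->
    infoset_depth I = size (own_history i v).
  move=> vI; rewrite /infoset_depth; case: pickP => [w wI|/(_ v)].
    by rewrite (PR i I w v).
  by rewrite vI.
have [v vJ] := infoset_neq0 J; rewrite (parent_sqE PR vJ) (depthE J v) // /last_sq.
case/lastP E: (own_history i v) => [//|s q].
rewrite map_rcons last_rcons => -[qp]; rewrite {}qp in E.
have [u uI us] := own_history_rcons E.
by rewrite (depthE _ u) // us size_rcons.
Qed.

(** Bellman equations: [g p] is the immediate payoff of [p], [W p] adds the values of the
    information sets directly following it, and [b] is a best action. Perfect recall makes the sets
    a forest graded by depth, so iterating [step] solves them. *)
Lemma backward_induction (R : realType) n (G : game R n) i (g : nesq G i -> R) :
  perfect_recall G ->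
  exists (V : infoset G i -> R) (b : infoset G i -> nesq G i),
  let W p := g p + \sum_(J | parent_sq J == Some p) V J in
  [/\ forall I, sq_info (b I) = I,
      forall p, W p <= V (sq_info p) &
      forall I, V I = W (b I)].
Proof.
move=> PR; have [p0 p0I] := fin_all_exists (@infoset_sq R n G i).
pose W V p := g p + \sum_(J | parent_sq J == Some p) V J.
pose best V (I : infoset G i) := [arg max_(p > p0 I | sq_info p == I) W V p]%O.
have bestP V I : sq_info (best V I) = I /\
    forall p, sq_info p = I -> W V p <= W V (best V I).
  rewrite /best; case: arg_maxP => [|q /eqP qI qmax]; first exact/eqP.
  by split=> // p /eqP; apply: qmax.
pose step V I := W V (best V I).
(* [N] exceeds every depth, so [step] is applied at least once at each [I]. *)
pose N := (\max_(I : infoset G i) infoset_depth I).+1.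
(* Information sets one level deeper are iterated exactly once less. *)
pose V I := iter (N - infoset_depth I) step (fun=> 0) I.
have WE p : W V p = W (iter (N - infoset_depth (sq_info p)).-1 step (fun=> 0)) p.
  congr (_ + _); apply: eq_bigr => J /eqP/(infoset_depth_child PR) dJ.
  by rewrite /V dJ subnS.
pose rest (I : infoset G i) := iter (N - infoset_depth I).-1 step (fun=> 0).
have VE I : V I = W (rest I) (best (rest I) I).
  rewrite /V /rest; case dE: (N - infoset_depth I)%N => [|m] //.
  by move/eqP: dE; rewrite subn_eq0 leqNgt ltnS leq_bigmax.
exists V, (fun I => best (rest I) I); split=> [I|p|I].
- by case: (bestP (rest I) I).
- rewrite -/(W V p) WE VE; exact: (bestP _ _).2.
- by rewrite -/(W V _) WE (bestP _ _).1 VE.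
Qed.

Lemma trmx_F_mulE (R : realType) n (G : game R n) i (v0 : R)
    (V : infoset G i -> R) (s : sq G i) :
  ((F_mx G i)^T *m col_mx v0%:M (\col_k V (enum_val k))) (enum_rank s) 0 =
  (s == None)%:R * v0 + (if s is Some p then V (sq_info p) else 0)
    - \sum_(J | parent_sq J == s) V J.
Proof.
rewrite tr_col_mx mul_row_col mxE -addrA; congr (_ + _).
  by rewrite mxE big_ord1 !mxE enum_rankK mulr1n.
rewrite mxE (reindex (@enum_rank (infoset G i))) /=; last first.
  by exists enum_val => I _; rewrite ?enum_valK ?enum_rankK.
under eq_bigr do rewrite !mxE !enum_rankK mulrBl.
rewrite sumrB; congr (_ - _); last first.
  rewrite [RHS]big_mkcond; apply: eq_bigr => J _; rewrite eq_sym.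
  by case: ifP; rewrite ?mul1r ?mul0r.
case: s => [p|]; last by rewrite big1 // => J _; rewrite mul0r.
rewrite (bigD1 (sq_info p)) //= eqxx mul1r big1 ?addr0 // => J.
by rewrite eq_sym => /negPf->; rewrite mul0r.
Qed.

(** The Bellman values for the payoffs [A^T xi] are dual feasible, with slack zero at every best
    action. A plan playing only best actions puts mass on tight rows only, so its gap is zero. *)
Lemma player_lp_optimum (R : realType) n (G : game R n) i (xi : corr_vec G) :
  perfect_recall G ->
  exists (v : 'cV[R]_(1 + #|{: infoset G i}|)) (pi : plan G i),
    (forall l, 0 <= ((F_mx G i)^T *m v - (A_mx G i)^T *m xi) l 0) /\
    (v^T *m f_vec G i) 0 0 =
    (xi^T *m A_mx G i *m realization (dirac R pi)) 0 0.
Proof.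
move=> PR; pose g (s : sq G i) := ((A_mx G i)^T *m xi) (enum_rank s) 0.
have [V [b [bI Wle Wb]]] := backward_induction (fun p => g (Some p)) PR.
(* The value at the root, chosen to make the row of the empty sequence tight. *)
pose v0 := g None + \sum_(J | parent_sq J == None) V J.
have [pi piP] := plan_of_choice bI.
exists (col_mx v0%:M (\col_k V (enum_val k))), pi.
set v := col_mx _ _.
have slackE s : ((F_mx G i)^T *m v - (A_mx G i)^T *m xi) (enum_rank s) 0 =
    if s is Some p
    then V (sq_info p) - (g (Some p) + \sum_(J | parent_sq J == Some p) V J)
    else 0.
  rewrite mxE [X in _ + X]mxE -/(g s) trmx_F_mulE; case: s => [p|] /=.
    by rewrite mul0r add0r opprD addrAC addrA.
  by rewrite mul1r addr0 /v0 addrK subrr.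
split=> [l|].
  rewrite -[l]enum_valK slackE; case: (enum_val l) => [p|//].
  by rewrite subr_ge0.
apply/eqP; rewrite -subr_eq0 lp_duality_gapE //; last exact: distribution_dirac.
apply/eqP/big1 => l _; rewrite [realization _ _ _]mxE sum_dirac -[l]enum_valK slackE enum_rankK.
case: (enum_val l) => [p|]; last by rewrite mul0r.
case: (boolP (pi \in _)) => [|_]; last by rewrite mulr0.
rewrite plans_Some // !inE => /andP[_ /eqP/piP pE].
by rewrite {1}pE bI Wb -pE subrr mul0r.
Qed.

(** [w] is the gap of the worst player [i0]. It is defined from [xi], so one value serves every [mu]
    inducing [xi]. *)
Lemma benefit_lp_value (R : realType) (n : nat) (G : game R n) (xi : corr_vec G) :
  (0 < n)%N -> perfect_recall G ->
  exists w : R,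
    is_minimum
      (fun u : R =>
         exists v : forall i : 'I_n, 'cV[R]_(1 + #|{: infoset G i}|),
           lp_constraints xi u v) w /\
    forall mu : {ffun profile G -> R}, xi = induced mu ->
      is_maximum
        (fun x : R =>
           exists (i : 'I_n) (muhat : {ffun plan G i -> R}),
             distribution muhat /\
             x = deviation_utility mu muhat - commit_utility i mu) w.
Proof.
move=> n_gt0 PR.
have [v vP] := fin_all_exists (fun i => player_lp_optimum i xi PR).
have [pi piP] := fin_all_exists vP.
pose y i := realization (dirac R (pi i)).
pose val i := (v i)^T *m f_vec G i.
pose gap i : R := (val i) 0 0 - ((b_vec G i)^T *m xi) 0 0.
have gapE i : gap i =
    (xi^T *m A_mx G i *m y i) 0 0 - ((b_vec G i)^T *m xi) 0 0.
  by rewrite /gap /val (piP i).2.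
have dualle i (v' : 'cV_(1 + #|{: infoset G i}|)) (muhat : {ffun plan G i -> R}) :
    distribution muhat ->
    (forall l, 0 <= ((F_mx G i)^T *m v' - (A_mx G i)^T *m xi) l 0) ->
    (xi^T *m A_mx G i *m realization muhat) 0 0 <= (v'^T *m f_vec G i) 0 0.
  move=> dmu v'ge; rewrite -subr_ge0 lp_duality_gapE // sumr_ge0 // => l _.
  by rewrite mulr_ge0 ?realization_ge0.
have [i0 i0max] : exists i0, forall i, gap i <= gap i0.
  by case: (arg_maxP gap (erefl : xpredT (Ordinal n_gt0))) => i0 _ i0max; exists i0 => i; apply: i0max.
exists (gap i0); split; [split|].
- exists v => i; split; last exact: (piP i).1.
  by move: (i0max i); rewrite /gap /val; lra.
- move=> u [v' v'P]; have [uv' v'F] := v'P i0; rewrite gapE.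
  have := dualle i0 (v' i0) (dirac R (pi i0)) (distribution_dirac _ _) v'F.
  by move: uv'; rewrite -/(y i0); lra.
- move=> mu xiE; split.
    exists i0, (dirac R (pi i0)); split; first exact: distribution_dirac.
    by rewrite gapE xiE A_mx_induced b_vec_induced.
  move=> _ [i [muhat [dmu ->]]]; apply: le_trans (i0max i).
  rewrite -A_mx_induced -b_vec_induced -xiE lerD2r.
  exact: dualle (piP i).1.
Qed.

(** * NFCCEs as a linear system over plan profiles *)

Definition utility (R : realType) n (G : game R n) (i : 'I_n) (pi : profile G) : R :=
  \sum_(z : leaf G) payoff i z * [forall j, pi j \in plans_leaf j z]%:R.

Definition deviate (R : realType) n (G : game R n) (pi : profile G) i
    (p : plan G i) : profile G :=
  [ffun j => dfwith pi p j].

Definition gain (R : realType) n (G : game R n) (t : {i : 'I_n & plan G i})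
    (pi : profile G) : R :=
  utility (tag t) (deviate pi (tagged t)) - utility (tag t) pi.

Lemma commit_utilityE (R : realType) n (G : game R n) (i : 'I_n)
    (mu : {ffun profile G -> R}) :
  commit_utility i mu = \sum_pi utility i pi * mu pi.
Proof.
under [RHS]eq_bigr do rewrite mulr_suml.
rewrite exchange_big; apply: eq_bigr => z _ /=.
rewrite mulr_sumr big_mkcond; apply: eq_bigr => pi _.
by case: ifP; rewrite ?mulr1 ?mulr0 ?mul0r.
Qed.

Lemma deviate_same (R : realType) n (G : game R n) (pi : profile G) i
    (p : plan G i) : deviate pi p i = p.
Proof. by rewrite ffunE dfwith_in. Qed.

Lemma deviate_other (R : realType) n (G : game R n) (pi : profile G) i
    (p : plan G i) j : j != i -> deviate pi p j = pi j.
Proof. by move=> ji; rewrite ffunE dfwith_out // eq_sym. Qed.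

Lemma deviation_utilityE (R : realType) n (G : game R n) i
    (mu : {ffun profile G -> R}) (muhat : {ffun plan G i -> R}) :
  deviation_utility mu muhat =
  \sum_p muhat p * \sum_pi utility i (deviate pi p) * mu pi.
Proof.
transitivity (\sum_(z : leaf G) \sum_p \sum_pi
    muhat p * (payoff i z *
      [forall j, deviate pi p j \in plans_leaf j z]%:R * mu pi)).
  apply: eq_bigr => z _; rewrite mulr_sumr big_mkcond; apply: eq_bigr => p _ /=.
  rewrite -mulr_sumr.
  have devE pi : [forall j, deviate pi p j \in plans_leaf j z] =
      (p \in plans_leaf i z) &&
      [forall j, (j != i) ==> (pi j \in plans_leaf j z)].
    apply/forallP/andP => [H|[pz /forallP H] j].
      split; first by have := H i; rewrite deviate_same.
      by apply/forallP => j; apply/implyP => ji; have := H j; rewrite deviate_other.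
    have [->|ji] := eqVneq j i; first by rewrite deviate_same.
    by rewrite deviate_other //; apply: (implyP (H j)).
  under [in RHS]eq_bigr do rewrite devE.
  case: (p \in _) => /=; last by rewrite mulr0 big1 ?mulr0 // => pi _; rewrite mul0r.
  rewrite mulrC; congr (_ * _); rewrite mulr_sumr big_mkcond.
  by apply: eq_bigr => pi _; case: ifP; rewrite ?mulr1 ?mulr0 ?mul0r.
rewrite exchange_big; apply: eq_bigr => p _ /=.
rewrite exchange_big mulr_sumr; apply: eq_bigr => pi _ /=.
by rewrite mulr_suml mulr_sumr.
Qed.

(** The benefit of [muhat] is the [muhat]-average of the benefits of pure deviations, so one
    inequality per player and pure plan suffices. *)
Lemma nfcceP (R : realType) n (G : game R n) (mu : {ffun profile G -> R}) :
  nfcce mu <->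
  distribution mu /\ forall t, \sum_pi gain t pi * mu pi <= 0.
Proof.
have benefitE i (muhat : {ffun plan G i -> R}) : distribution muhat ->
    deviation_utility mu muhat - commit_utility i mu =
    \sum_p muhat p * \sum_pi gain (Tagged (plan G) p) pi * mu pi.
  case=> _ m1; rewrite deviation_utilityE commit_utilityE.
  rewrite -[\sum_pi utility i pi * _]mul1r -m1 mulr_suml -sumrB.
  apply: eq_bigr => p _; rewrite -mulrBr -sumrB; congr (_ * _).
  by apply: eq_bigr => pi _; rewrite -mulrBl.
split=> -[dmu H]; split=> //.
  case=> i p.
  have := H i _ (distribution_dirac R p); rewrite -subr_le0 benefitE; last first.
    exact: distribution_dirac.
  by rewrite sum_dirac_mull.
move=> i muhat dm; rewrite -subr_le0 benefitE // sumr_le0 // => p _.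
by rewrite mulr_ge0_le0 //; case: dm.
Qed.

(** * Existence of an NFCCE *)

(* Exchanging the deviation with the prescribed plan is an involution that
   preserves the weights and changes the sign of the gain. *)
Lemma sum_product_gain (R : realType) n (G : game R n) (i : 'I_n)
    (w : forall j, plan G j -> R) :
  \sum_(pi : profile G) \sum_(p : plan G i)
    (\prod_j w j (pi j)) * w i p * gain (Tagged (plan G) p) pi = 0.
Proof.
rewrite pair_big /=; set S := \sum_(q | _) _.
pose swap (q : profile G * plan G i) := (deviate q.1 q.2, q.1 i).
have swapK : involutive swap.
  case=> pi p; rewrite /swap /= deviate_same; congr (_, _).
  apply/ffunP => j; have [->|ji] := eqVneq j i; first by rewrite deviate_same.
  by rewrite !deviate_other.
suff : - S == S by rewrite eqNr => /eqP.
apply/eqP; rewrite [RHS](reindex_inj (inv_inj swapK)) -sumrN.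
apply: eq_bigr => -[pi p] _; have [] := swapK (pi, p).
rewrite /= /gain /= => -> _.
have -> : (\prod_j w j (deviate pi p j)) * w i (pi i) =
    (\prod_j w j (pi j)) * w i p.
  rewrite (bigD1 i) //= [in RHS](bigD1 i) //= deviate_same.
  rewrite mulrAC [RHS]mulrC [RHS]mulrA; congr (_ * _).
  by apply: eq_bigr => j ji; rewrite deviate_other.
by rewrite -mulrN opprB.
Qed.

Lemma nfcce_exists (R : realType) n (G : game R n) :
  exists mu : {ffun profile G -> R}, nfcce mu.
Proof.
(* Otherwise some weights l make every total gain positive, but the gains
   average to 0 under the product of the weights l (i, _), replaced by the
   constant 1 where they all vanish. *)
case: (simplex_alternative (@gain R n G)) => [[mu dmu gmu]|[l l_ge0 gl]].
  by exists mu; apply/nfcceP.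
pose w (i : 'I_n) (p : plan G i) := if \sum_(q : plan G i) l (Tagged _ q) == 0 then 1
                                      else l (Tagged (plan G) p).
(* [k i] vanishes exactly when all weights of player [i] do, so that [l] factors as [k i * w i] in
   either case. *)
pose k i : R := (\sum_(q : plan G i) l (Tagged _ q) != 0)%:R.
have lE i (p : plan G i) : l (Tagged _ p) = k i * w i p.
  rewrite /k /w; case: eqP => [/eqP|_]; last by rewrite mul1r.
  by rewrite psumr_eq0 // mul0r => /allP/(_ p (mem_index_enum p))/eqP.
have sum_tagged (F : {i : 'I_n & plan G i} -> R) :
    \sum_t F t = \sum_(i < n) \sum_(p : plan G i) F (Tagged (plan G) p).
  by rewrite sig_big_dep; apply: eq_big => -[].
have w_ge0 i (p : plan G i) : 0 <= w i p by rewrite /w; case: ifP.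
have /fin_all_exists[q qP] i : exists p : plan G i, 0 < w i p.
  rewrite /w; case: eqP => [_|/eqP L0].
    by have [p] := plan_inhabited G i; exists p.
  by move: L0; rewrite psumr_neq0 // => /hasP[p _ lp]; exists p.
pose X (pi : profile G) := \prod_j w j (pi j).
have X_ge0 pi : 0 <= X pi by apply: prodr_ge0.
(* This sum is zero player by player, yet the certificate bounds it below by the total mass of [X],
   positive at the profile [q]. *)
suff : 0 < \sum_pi X pi * \sum_t l t * gain t pi.
  under eq_bigr do rewrite mulr_sumr.
  rewrite exchange_big sum_tagged /=.
  rewrite big1 ?ltxx // => i _; rewrite exchange_big.
  transitivity (k i * \sum_pi \sum_p X pi * w i p * gain (Tagged (plan G) p) pi).
    rewrite mulr_sumr; apply: eq_bigr => pi _; rewrite mulr_sumr.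
    by apply: eq_bigr => p _; rewrite lE -!mulrA mulrCA.
  by rewrite sum_product_gain mulr0.
apply: (@lt_le_trans _ _ (\sum_pi X pi)); last first.
  by apply: ler_sum => pi _; rewrite ler_peMr.
rewrite (bigD1 ([ffun i => q i] : profile G)) //= ltr_wpDr ?sumr_ge0 //.
by apply: prodr_gt0 => i _; rewrite ffunE.
Qed.

(** * Both programs *)

Theorem mainTheorem4 (R : realType) (n : nat) (n_gt0 : (0 < n)%N)
    (G : game R n) (PR : perfect_recall G) :
  (forall xi : corr_vec G, Xi xi ->
     exists w : R,
       is_minimum
         (fun u : R =>
            exists v : forall i : 'I_n, 'cV[R]_(1 + #|{: infoset G i}|),
              lp_constraints xi u v) w /\
       forall mu : {ffun profile G -> R}, distribution mu -> xi = induced mu ->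
         is_maximum
           (fun x : R =>
              exists (i : 'I_n) (muhat : {ffun plan G i -> R}),
                distribution muhat /\
                x = deviation_utility mu muhat - commit_utility i mu) w) /\
  (forall c : corr_vec G,
     (exists (xi : corr_vec G) (u : R)
             (v : forall i : 'I_n, 'cV[R]_(1 + #|{: infoset G i}|)),
        nfcce_lp_optimal c xi u v) /\
     (forall (xi : corr_vec G) (u : R)
             (v : forall i : 'I_n, 'cV[R]_(1 + #|{: infoset G i}|)),
        nfcce_lp_optimal c xi u v ->
        nfcce_plan xi /\
        forall xi' : corr_vec G, nfcce_plan xi' ->
          (c^T *m xi') 0 0 <= (c^T *m xi) 0 0)).
Proof.
split=> [xi _|c].
  have [w [wmin wmax]] := benefit_lp_value xi n_gt0 PR.
  by exists w; split=> // mu _; apply: wmax.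
have plan_feasible (xi : corr_vec G) : nfcce_plan xi -> exists u v, nfcce_lp_feasible xi u v.
  case=> mu [[dmu ce] xiE].
  have [w [[[v vP] _] /(_ mu xiE) [[i [muhat [dm wE]]] _]]] :=
    benefit_lp_value xi n_gt0 PR.
  exists w, v; split=> //; last by exists mu.
  by rewrite wE subr_le0; apply: ce.
have feasible_plan (xi : corr_vec G) u v : nfcce_lp_feasible xi u v -> nfcce_plan xi.
  case=> lp u_le0 [mu [dmu xiE]].
  have [w [[_ wmin] /(_ mu xiE) [_ wmax]]] := benefit_lp_value xi n_gt0 PR.
  exists mu; split=> //; split=> // i muhat dm; rewrite -subr_le0.
  apply: le_trans u_le0; apply: (@le_trans _ _ w); last by apply: wmin; exists v.
  by apply: wmax; exists i, muhat.
(* [induced] is linear, so the objective is linear in [mu] with coefficients read off at point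
   masses. *)
pose d (pi : profile G) := (c^T *m induced (dirac R pi)) 0 0.
have objE mu : (c^T *m induced mu) 0 0 = \sum_pi d pi * mu pi.
  rewrite mxE; under [RHS]eq_bigr do rewrite /d mxE mulr_suml.
  rewrite exchange_big; apply: eq_bigr => k _ /=.
  rewrite mxE [X in _ * X]mxE mulr_sumr big_mkcond; apply: eq_bigr => pi _.
  by rewrite mxE sum_dirac; case: ifP; rewrite ?mulr1 ?mulr0 ?mul0r.
split.
  have [mu ce mumax] := simplex_lp_attained d (@nfcceP R n G) (nfcce_exists G).
  have [u [v feas]] : exists u v, nfcce_lp_feasible (induced mu) u v.
    by apply: plan_feasible; exists mu.
  exists (induced mu), u, v; split=> // xi' u' v' /feasible_plan[mu' [ce' ->]].
  by rewrite !objE; apply: mumax.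
move=> xi u v [feas opt]; split=> [|xi' /plan_feasible[u' [v']]].
  exact: feasible_plan feas.
exact: opt.
Qed.
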